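(* Let $Q$ be a strong commutative semicartesian quantale. Every $Q$-set $X$ is relationally isomorphic to its own Scott completion, i.e. $X$ is isomorphic to $\mathfrak{S}(X)$ in the category $\mathbf{QSet}_r$ of $Q$-sets and relational morphisms. Moreover, Scott completion is invariant under functional isomorphisms: if $X$ and $Y$ are $Q$-sets that are isomorphic in the category $\mathbf{QSet}_f$ of $Q$-sets and functional morphisms, then $\mathfrak{S}(X)$ and $\mathfrak{S}(Y)$ are isomorphic in $\mathbf{QSet}_f$.
   Context: A quantale is a complete lattice $(Q,\le)$ with an associative binary operation $\otimes$ that distributes over arbitrary suprema in each variable. It is commutative if $\otimes$ is commutative; semicartesian if $a\otimes b\le a\wedge b$ for all $a,b$; strong if for every $e\in Q$ with $e=e\otimes e$ and every $A\subseteq Q$, $e\le\bigvee_{a\in A}a$ implies $e\le\bigvee_{a\in A}a\otimes a$. A $Q$-set is a set $X$ with a map $\delta:X\times X\to Q$ such that for all $x,y,z$: $\delta(x,y)=\delta(y,x)$; $\delta(x,y)\otimes\delta(y,z)\le\delta(x,z)$; $\delta(x,x)\otimes\delta(x,y)=\delta(x,y)$. The extent of $x$ is $Ex:=\delta(x,x)$. A functional morphism $f:X\to Y$ is a function between the underlying sets such that $\delta(x,x')\le\delta(f(x),f(x'))$ and $Ef(x)=Ex$ for all $x,x'\in X$. With the usual composition of functions and identity functions, these are the morphisms of the category $\mathbf{QSet}_f$ of $Q$-sets. A functional isomorphism is an isomorphism in $\mathbf{QSet}_f$. A relational morphism $\phi:X\to Y$ is a function $\phi:X\times Y\to Q$ such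 that for all $x,x'\in X$, $y,y'\in Y$: $\delta(x,x')\otimes\phi(x,y)\le\phi(x',y)$; $\phi(x,y)\otimes\delta(y,y')\le\phi(x,y')$; $\phi(x,y)\otimes\phi(x,y')\le\delta(y,y')$; $\phi(x,y)\otimes Ey=\phi(x,y)$; $Ex\otimes\phi(x,y)=\phi(x,y)$; $\bigvee_{y\in Y}\phi(x,y)=Ex$. Composition is $[\psi\circ\phi](x,z)=\bigvee_{y\in Y}\phi(x,y)\otimes\psi(y,z)$ and the identity of $X$ is $\delta_X$; this is the category $\mathbf{QSet}_r$. A singleton on $X$ is a map $\sigma:X\to Q$ such that for all $x,y\in X$: $\sigma(x)\otimes Ex=\sigma(x)$; $\sigma(x)\otimes\delta(x,y)\le\sigma(y)$; $\sigma(x)\otimes\sigma(y)\le\delta(x,y)$; $\sigma(x)\otimes\bigvee_{y\in X}\sigma(y)=\sigma(x)$. The Scott completion $\mathfrak{S}(X)$ is the set of singletons on $X$ with $\delta(\sigma,\xi)=\bigvee_{x\in X}\sigma(x)\otimes\xi(x)$; for strong $Q$ this is a $Q$-set. *)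

(* Defs.v *)
From HB Require Import structures.
From mathcomp Require Import all_boot all_order boolp classical_sets.

Set Implicit Arguments.
Unset Strict Implicit.
Unset Printing Implicit Defensive.

Import Order.TTheory.
#[local] Obligation Tactic := idtac.
Local Open Scope order_scope.
Local Open Scope classical_set_scope.

Reserved Notation "x ⊗ y" (at level 40, left associativity).
Reserved Notation "\qsup_ ( x : T ) F"
  (at level 41, F at level 41, x name, T at level 200).

(* Order.Lattice puts a boolean order on a choiceType; with the classical
   axioms of boolp, every complete lattice is of this form. [qsup] is data,
   but it is determined by the order. *)
HB.mixin Record Lattice_isComplete d Q of Order.Lattice d Q := {
  qsup : set Q -> Q;
  qsup_supremums : forall A : set Q, supremums A (qsup A)
}.

#[short(type="completeLatticeType")]
HB.structure Definition CompleteLattice d :=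
  { Q of Order.Lattice d Q & Lattice_isComplete d Q }.

Notation "\qsup_ ( x : T ) F" := (qsup (range (fun x : T => F))).

HB.mixin Record CompleteLattice_isQuantale d Q of CompleteLattice d Q := {
  tensor : Q -> Q -> Q;
  tensorA : associative tensor;
  tensor_qsupl : forall (A : set Q) (b : Q),
    tensor (qsup A) b = qsup [set tensor a b | a in A];
  tensor_qsupr : forall (a : Q) (B : set Q),
    tensor a (qsup B) = qsup [set tensor a b | b in B]
}.

#[short(type="quantaleType")]
HB.structure Definition Quantale d :=
  { Q of CompleteLattice d Q & CompleteLattice_isQuantale d Q }.

Notation "x ⊗ y" := (tensor x y).

Definition semicartesian d (Q : quantaleType d) : Prop :=
  forall a b : Q, a ⊗ b <= (a `&` b)%O.

Definition strong d (Q : quantaleType d) : Prop :=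
  forall (e : Q) (A : set Q), e = e ⊗ e ->
    e <= qsup A -> e <= qsup [set a ⊗ a | a in A].

HB.mixin Record Quantale_isStrongCommSemicartesian d Q of Quantale d Q := {
  tensorC : commutative (@tensor d Q);
  tensor_semicartesian : semicartesian Q;
  tensor_strong : strong Q
}.

#[short(type="scsQuantaleType")]
HB.structure Definition StrongCommSemicartesianQuantale d :=
  { Q of Quantale d Q & Quantale_isStrongCommSemicartesian d Q }.

Section QuantaleTheory.
Context {d : Order.disp_t} {Q : quantaleType d}.
Implicit Types (a b c : Q) (I J : Type).

Lemma qsup_ge (A : set Q) a : A a -> a <= qsup A.
Proof. by move=> Aa; have [ubA _] := qsup_supremums A; exact: ubA. Qed.

Lemma qsup_le (A : set Q) b : (forall a, A a -> a <= b) -> qsup A <= b.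
Proof. by move=> leAb; have [_ lbA] := qsup_supremums A; exact: lbA. Qed.

Lemma fqsup_ge I (F : I -> Q) i : F i <= \qsup_(j : I) F j.
Proof. by apply: qsup_ge; exists i. Qed.

Lemma fqsup_le I (F : I -> Q) b :
  (forall i, F i <= b) -> \qsup_(i : I) F i <= b.
Proof. by move=> leFb; apply: qsup_le => _ [i _ <-]. Qed.

Lemma eq_fqsup I (F G : I -> Q) :
  F =1 G -> \qsup_(i : I) F i = \qsup_(i : I) G i.
Proof. by move=> /funext ->. Qed.

Lemma fqsup_tensorl I (F : I -> Q) b :
  (\qsup_(i : I) F i) ⊗ b = \qsup_(i : I) (F i ⊗ b).
Proof. by rewrite tensor_qsupl image_comp. Qed.

Lemma fqsup_tensorr a I (F : I -> Q) :
  a ⊗ (\qsup_(i : I) F i) = \qsup_(i : I) (a ⊗ F i).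
Proof. by rewrite tensor_qsupr image_comp. Qed.

Lemma exchange_fqsup I J (F : I -> J -> Q) :
  \qsup_(i : I) \qsup_(j : J) F i j = \qsup_(j : J) \qsup_(i : I) F i j.
Proof.
apply/le_anti/andP; split; apply: fqsup_le => i; apply: fqsup_le => j.
  exact: le_trans (fqsup_ge (F^~ j) i) (fqsup_ge _ j).
exact: le_trans (fqsup_ge (F j) i) (fqsup_ge (fun k => \qsup_(l : J) F k l) j).
Qed.

Lemma le_tensor2l a b c : b <= c -> a ⊗ b <= a ⊗ c.
Proof.
move=> lebc; have -> : c = qsup [set b; c].
  apply/le_anti/andP; split; first by apply: qsup_ge; right.
  by apply: qsup_le => _ [] ->.
by rewrite tensor_qsupr; apply: qsup_ge; exists b => //; left.
Qed.

Lemma le_tensor2r a b c : b <= c -> b ⊗ a <= c ⊗ a.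
Proof.
move=> lebc; have -> : c = qsup [set b; c].
  apply/le_anti/andP; split; first by apply: qsup_ge; right.
  by apply: qsup_le => _ [] ->.
by rewrite tensor_qsupl; apply: qsup_ge; exists b => //; left.
Qed.

Lemma le_tensor a b a' b' : a <= a' -> b <= b' -> a ⊗ b <= a' ⊗ b'.
Proof.
by move=> la lb; apply: le_trans (le_tensor2l _ lb) (le_tensor2r _ la).
Qed.

End QuantaleTheory.

Lemma tensor_lel d (Q : scsQuantaleType d) (a b : Q) : a ⊗ b <= a.
Proof. exact: le_trans (tensor_semicartesian a b) (leIl _ _). Qed.

Lemma tensor_ler d (Q : scsQuantaleType d) (a b : Q) : a ⊗ b <= b.
Proof. exact: le_trans (tensor_semicartesian a b) (leIr _ _). Qed.

Record category := Category {
  obj :> Type;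
  hom : obj -> obj -> Type;
  idm : forall X, hom X X;
  compm : forall X Y Z, hom Y Z -> hom X Y -> hom X Z;
  compm_idl : forall X Y (f : hom X Y), compm (idm Y) f = f;
  compm_idr : forall X Y (f : hom X Y), compm f (idm X) = f;
  compmA : forall X Y Z W (h : hom Z W) (g : hom Y Z) (f : hom X Y),
    compm h (compm g f) = compm (compm h g) f
}.

Definition isomorphic (C : category) (X Y : C) : Prop :=
  exists (f : hom X Y) (g : hom Y X), compm g f = idm X /\ compm f g = idm Y.

Record QSet d (Q : quantaleType d) := MkQSet {
  carrier :> Type;
  delta : carrier -> carrier -> Q;
  delta_sym : forall x y, delta x y = delta y x;
  delta_trans : forall x y z, delta x y ⊗ delta y z <= delta x z;
  delta_ext : forall x y, delta x x ⊗ delta x y = delta x y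
}.

Definition extent d (Q : quantaleType d) (X : QSet Q) (x : X) : Q := delta x x.

Section Functional.
Context {d : Order.disp_t} {Q : quantaleType d}.

Record fmorph (X Y : QSet Q) := FMorph {
  fmorph_fun :> X -> Y;
  fmorph_delta : forall x x', delta x x' <= delta (fmorph_fun x) (fmorph_fun x');
  fmorph_extent : forall x, extent (fmorph_fun x) = extent x
}.

Lemma fmorph_eq (X Y : QSet Q) (f g : fmorph X Y) :
  fmorph_fun f = fmorph_fun g -> f = g.
Proof.
case: f g => f f1 f2 [g g1 g2] /= fg; rewrite -{}fg in g1 g2 *.
by congr FMorph; exact: Prop_irrelevance.
Qed.

Definition fmorph_id (X : QSet Q) : fmorph X X :=
  @FMorph X X id (fun _ _ => lexx _) (fun _ => erefl).

Program Definition fmorph_comp (X Y Z : QSet Q)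
    (g : fmorph Y Z) (f : fmorph X Y) : fmorph X Z := @FMorph X Z (g \o f) _ _.
Next Obligation.
move=> X Y Z g f x x' /=; apply: le_trans (fmorph_delta g _ _).
exact: fmorph_delta.
Qed.
Next Obligation. by move=> X Y Z g f x /=; rewrite !fmorph_extent. Qed.

End Functional.

Program Definition QSet_f d (Q : quantaleType d) : category :=
  @Category (QSet Q) fmorph fmorph_id fmorph_comp _ _ _.
Next Obligation. by move=> *; exact: fmorph_eq. Qed.
Next Obligation. by move=> *; exact: fmorph_eq. Qed.
Next Obligation. by move=> *; exact: fmorph_eq. Qed.

Section Relational.
Context {d : Order.disp_t} {Q : scsQuantaleType d}.

Record rmorph (X Y : QSet Q) := RMorph {
  rmorph_fun :> X -> Y -> Q;
  rmorph_deltal : forall x x' y,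
    delta x x' ⊗ rmorph_fun x y <= rmorph_fun x' y;
  rmorph_deltar : forall x y y',
    rmorph_fun x y ⊗ delta y y' <= rmorph_fun x y';
  rmorph_single : forall x y y',
    rmorph_fun x y ⊗ rmorph_fun x y' <= delta y y';
  rmorph_extr : forall x y, rmorph_fun x y ⊗ extent y = rmorph_fun x y;
  rmorph_extl : forall x y, extent x ⊗ rmorph_fun x y = rmorph_fun x y;
  rmorph_total : forall x, \qsup_(y : Y) rmorph_fun x y = extent x
}.

Lemma rmorph_eq (X Y : QSet Q) (f g : rmorph X Y) :
  (forall x y, f x y = g x y) -> f = g.
Proof.
move=> fg; have {fg} : rmorph_fun f = rmorph_fun g by apply/funext => x; exact/funext.
case: f g => f f1 f2 f3 f4 f5 f6 [g g1 g2 g3 g4 g5 g6] /= fg.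
rewrite -{}fg in g1 g2 g3 g4 g5 g6 *.
by congr RMorph; exact: Prop_irrelevance.
Qed.

Lemma extent_deltar (X : QSet Q) (x y : X) : delta x y ⊗ extent y = delta x y.
Proof. by rewrite tensorC delta_sym delta_ext. Qed.

Program Definition rmorph_id (X : QSet Q) : rmorph X X :=
  @RMorph X X (@delta d Q X) _ _ _ _ _ _.
Next Obligation.
by move=> X x x' y; rewrite (delta_sym x x'); exact: delta_trans.
Qed.
Next Obligation. by move=> X x y y'; exact: delta_trans. Qed.
Next Obligation.
by move=> X x y y'; rewrite (delta_sym x y); exact: delta_trans.
Qed.
Next Obligation. by move=> X x y; exact: extent_deltar. Qed.
Next Obligation. by move=> X x y; exact: delta_ext. Qed.
Next Obligation.
move=> X x; apply/le_anti/andP; split.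
  by apply: fqsup_le => y; rewrite -delta_ext; exact: tensor_lel.
exact: (fqsup_ge (delta x) x).
Qed.

Program Definition rmorph_comp (X Y Z : QSet Q)
    (psi : rmorph Y Z) (phi : rmorph X Y) : rmorph X Z :=
  @RMorph X Z (fun x z => \qsup_(y : Y) (phi x y ⊗ psi y z)) _ _ _ _ _ _.
Next Obligation.
move=> X Y Z psi phi x x' z; rewrite fqsup_tensorr; apply: fqsup_le => y.
apply: le_trans (fqsup_ge (fun y => phi x' y ⊗ psi y z) y).
by rewrite tensorA; apply: le_tensor => //; exact: rmorph_deltal.
Qed.
Next Obligation.
move=> X Y Z psi phi x z z'; rewrite fqsup_tensorl; apply: fqsup_le => y.
apply: le_trans (fqsup_ge (fun y => phi x y ⊗ psi y z') y).
by rewrite -tensorA; apply: le_tensor => //; exact: rmorph_deltar.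
Qed.
Next Obligation.
move=> X Y Z psi phi x z z'; rewrite fqsup_tensorl; apply: fqsup_le => y.
rewrite fqsup_tensorr; apply: fqsup_le => y'.
have -> : phi x y ⊗ psi y z ⊗ (phi x y' ⊗ psi y' z')
        = phi x y ⊗ phi x y' ⊗ psi y z ⊗ psi y' z'.
  by rewrite !tensorA -(tensorA (phi x y)) (tensorC (psi y z)) !tensorA.
apply: le_trans (rmorph_single psi y' z z').
apply: le_tensor => //; apply: le_trans (rmorph_deltal psi y y' z).
by apply: le_tensor => //; exact: rmorph_single.
Qed.
Next Obligation.
move=> X Y Z psi phi x z; rewrite fqsup_tensorl; apply: eq_fqsup => y.
by rewrite -tensorA rmorph_extr.
Qed.
Next Obligation.
move=> X Y Z psi phi x z; rewrite fqsup_tensorr; apply: eq_fqsup => y.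
by rewrite tensorA rmorph_extl.
Qed.
Next Obligation.
move=> X Y Z psi phi x; rewrite exchange_fqsup -[RHS](rmorph_total phi).
by apply: eq_fqsup => y; rewrite -fqsup_tensorr rmorph_total rmorph_extr.
Qed.

End Relational.

Program Definition QSet_r d (Q : scsQuantaleType d) : category :=
  @Category (QSet Q) rmorph rmorph_id rmorph_comp _ _ _.
Next Obligation.
move=> d Q X Y f; apply: rmorph_eq => x y /=; apply/le_anti/andP; split.
  by apply: fqsup_le => z; exact: rmorph_deltar.
by rewrite -[leLHS]rmorph_extr; exact: (fqsup_ge (fun z => f x z ⊗ delta z y)).
Qed.
Next Obligation.
move=> d Q X Y f; apply: rmorph_eq => x y /=; apply/le_anti/andP; split.
  by apply: fqsup_le => z; rewrite delta_sym; exact: rmorph_deltal.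
by rewrite -[leLHS]rmorph_extl; exact: (fqsup_ge (fun z => delta x z ⊗ f z y)).
Qed.
Next Obligation.
move=> d Q X Y Z W h g f; apply: rmorph_eq => x w /=.
under eq_fqsup do rewrite fqsup_tensorl.
rewrite exchange_fqsup; apply: eq_fqsup => y.
by rewrite fqsup_tensorr; apply: eq_fqsup => z; rewrite tensorA.
Qed.

Section Scott.
Context {d : Order.disp_t} {Q : scsQuantaleType d}.

Record singleton (X : QSet Q) := Singleton {
  singleton_fun :> X -> Q;
  singleton_ext : forall x, singleton_fun x ⊗ extent x = singleton_fun x;
  singleton_delta : forall x y,
    singleton_fun x ⊗ delta x y <= singleton_fun y;
  singleton_single : forall x y,
    singleton_fun x ⊗ singleton_fun y <= delta x y;
  singleton_sup : forall x,
    singleton_fun x ⊗ (\qsup_(y : X) singleton_fun y) = singleton_fun x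
}.

Definition singleton_dist (X : QSet Q) (sigma xi : singleton X) : Q :=
  \qsup_(x : X) (sigma x ⊗ xi x).

Lemma singleton_dist_idem (X : QSet Q) (sigma : singleton X) x :
  singleton_dist sigma sigma ⊗ sigma x = sigma x.
Proof.
apply/le_anti/andP; split; first exact: tensor_ler.
rewrite -[leLHS]singleton_sup tensorC; apply: le_tensor => //.
have := @tensor_strong d Q (\qsup_(y : X) sigma y) (range sigma).
rewrite image_comp; apply => //; rewrite fqsup_tensorl.
by apply/esym/eq_fqsup => y; rewrite singleton_sup.
Qed.

(* [tensor_strong] enters through [singleton_dist_idem]: it is what makes the
   set of singletons satisfy [delta_ext]. *)
Program Definition scott (X : QSet Q) : QSet Q :=
  @MkQSet d Q (singleton X) (@singleton_dist X) _ _ _.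
Next Obligation.
by move=> X sigma xi; apply: eq_fqsup => x; rewrite tensorC.
Qed.
Next Obligation.
move=> X sigma xi zeta; rewrite fqsup_tensorl; apply: fqsup_le => x.
rewrite fqsup_tensorr; apply: fqsup_le => y.
apply: le_trans (fqsup_ge (fun y => sigma y ⊗ zeta y) y).
rewrite tensorA; apply: le_tensor => //.
apply: le_trans (singleton_delta sigma x y); rewrite -tensorA.
by apply: le_tensor => //; exact: singleton_single.
Qed.
Next Obligation.
move=> X sigma xi; rewrite {2}/singleton_dist fqsup_tensorr.
by apply: eq_fqsup => x; rewrite tensorA singleton_dist_idem.
Qed.

End Scott.

(* Main.v *)
Require Import Defs.
From mathcomp Require Import all_boot all_order.
From mathcomp Require Import boolp classical_sets.

(** A singleton [sigma] on [X] should be read as a virtual point of [X], with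
    [sigma x] the degree to which that point is equal to [x].  This reading
    produces both relational morphisms at once: the evaluation
    [(x, sigma) |-> sigma x] is a morphism [X -> scott X] and its transpose is
    a morphism [scott X -> X].  Transitivity of equality degrees
    ([singleton_dist_trans]) makes the evaluation compatible with the distance
    of singletons, and strength of the quantale enters through
    [singleton_dist_idem], which says that the extent of [sigma] acts as a unit
    on the values of [sigma].  The composite on [scott X] is by definition the
    distance of singletons.  The composite on [X] sends [(x, y)] to the supremum
    of [sigma x ⊗ sigma y] over all singletons: it is bounded by [delta x y]
    since [sigma] is a singleton, and the bound is attained at the singleton
    [delta x] represented by [x] ([representable]).  The same singleton attains
    the supremum in the totality condition of [X -> scott X].

    For the second claim, an isomorphism in the functional category is a
    bijection that preserves [delta] exactly, since both it and its inverse can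
    only increase [delta].  Singletons and their distance are expressed through
    [delta] and suprema over the carrier, so they can be transported along such
    a bijection by precomposition with its inverse ([scott_map]). *)

Set Implicit Arguments.
Unset Strict Implicit.
Unset Printing Implicit Defensive.

Import Order.TTheory.
Local Open Scope order_scope.
Local Open Scope classical_set_scope.

Lemma fqsup_reindex d (Q : quantaleType d) (I J : Type) (h : J -> I)
    (h' : I -> J) (F : I -> Q) :
  cancel h' h -> \qsup_(j : J) F (h j) = \qsup_(i : I) F i.
Proof.
move=> h'K; apply/le_anti/andP; split; apply: fqsup_le => i.
  exact: (fqsup_ge F).
by rewrite -[in leLHS](h'K i); exact: (fqsup_ge (F \o h)).
Qed.

Section RelationalCompletion.
Context {d : Order.disp_t} {Q : scsQuantaleType d} (X : QSet Q).
Implicit Types (x y : X) (sigma xi : singleton X).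

Lemma fqsup_delta x : \qsup_(y : X) delta x y = extent x.
Proof. exact: rmorph_total (rmorph_id X) x. Qed.

Lemma representable_sup x y :
  delta x y ⊗ (\qsup_(z : X) delta x z) = delta x y.
Proof. by rewrite fqsup_delta tensorC; exact: delta_ext. Qed.

Definition representable x : singleton X :=
  Singleton (@extent_deltar _ _ X x) (@delta_trans _ _ X x)
    (rmorph_single (rmorph_id X) x) (representable_sup x).

(** If [sigma] equals both [x] and some [y], then [x] equals [y]; if moreover
    [xi] equals that [y], then [xi] equals [x]. *)
Lemma singleton_dist_trans sigma xi x :
  sigma x ⊗ singleton_dist sigma xi <= xi x.
Proof.
rewrite fqsup_tensorr; apply: fqsup_le => y; rewrite tensorA.
apply: le_trans (singleton_delta xi y x); rewrite tensorC delta_sym.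
by apply: le_tensor2l; exact: singleton_single.
Qed.

(** A value of [sigma] is unchanged by tensoring with the extent of [sigma],
    and a tensor lies below its factors, so the extent bounds every value.  In
    the other direction [sigma x ⊗ sigma x <= sigma x]. *)
Lemma fqsup_singleton sigma :
  \qsup_(x : X) sigma x = singleton_dist sigma sigma.
Proof.
apply/le_anti/andP; split; apply: fqsup_le => x.
  by rewrite -singleton_dist_idem; exact: tensor_lel.
exact: le_trans (tensor_lel _ _) (fqsup_ge sigma x).
Qed.

Lemma fqsup_eval x : \qsup_(sigma : singleton X) sigma x = extent x.
Proof.
apply/le_anti/andP; split.
  by apply: fqsup_le => sigma; rewrite -singleton_ext; exact: tensor_ler.
exact: (fqsup_ge (fun sigma : singleton X => sigma x) (representable x)).
Qed.

Program Definition to_scott : rmorph X (scott X) :=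
  @RMorph _ _ X (scott X) (fun x (sigma : singleton X) => sigma x) _ _ _ _ _ _.
Next Obligation. by rewrite tensorC; exact: singleton_delta. Qed.
Next Obligation. exact: singleton_dist_trans. Qed.
Next Obligation.
exact: (fqsup_ge (fun x => (y : singleton X) x ⊗ (y' : singleton X) x)).
Qed.
Next Obligation. by rewrite tensorC; exact: singleton_dist_idem. Qed.
Next Obligation. by rewrite tensorC; exact: singleton_ext. Qed.
Next Obligation. exact: fqsup_eval. Qed.

Program Definition of_scott : rmorph (scott X) X :=
  @RMorph _ _ (scott X) X (fun (sigma : singleton X) x => sigma x) _ _ _ _ _ _.
Next Obligation. by rewrite tensorC; exact: singleton_dist_trans. Qed.
Next Obligation. exact: singleton_delta. Qed.
Next Obligation. exact: singleton_single. Qed.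
Next Obligation. exact: singleton_ext. Qed.
Next Obligation. exact: singleton_dist_idem. Qed.
Next Obligation. exact: fqsup_singleton. Qed.

Lemma to_scottK : rmorph_comp of_scott to_scott = rmorph_id X.
Proof.
apply: rmorph_eq => x y /=; apply/le_anti/andP; split.
  by apply: fqsup_le => sigma; exact: singleton_single.
rewrite -[leLHS]delta_ext.
exact: (fqsup_ge (fun sigma : singleton X => sigma x ⊗ sigma y)
                 (representable x)).
Qed.

Lemma of_scottK : rmorph_comp to_scott of_scott = rmorph_id (scott X).
Proof. exact: rmorph_eq. Qed.

End RelationalCompletion.

Section FunctionalInvariance.
Context {d : Order.disp_t} {Q : scsQuantaleType d}.

Lemma singleton_eq (X : QSet Q) (sigma xi : singleton X) :
  singleton_fun sigma = singleton_fun xi -> sigma = xi.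
Proof.
case: sigma xi => s s1 s2 s3 s4 [t t1 t2 t3 t4] /= st.
rewrite -{}st in t1 t2 t3 t4 *.
by congr Singleton; exact: Prop_irrelevance.
Qed.

Section Transport.
Variables (X Y : QSet Q) (f : fmorph X Y) (g : fmorph Y X).
Hypotheses (fK : cancel f g) (gK : cancel g f).

Lemma fmorph_isometry y y' : delta (g y) (g y') = delta y y'.
Proof.
apply/le_anti/andP; split; last exact: fmorph_delta.
by rewrite -[y in leRHS]gK -[y' in leRHS]gK; exact: fmorph_delta.
Qed.

Program Definition singleton_map (sigma : singleton X) : singleton Y :=
  @Singleton _ _ Y (sigma \o g) _ _ _ _.
Next Obligation. by rewrite /= -(fmorph_extent g) singleton_ext. Qed.
Next Obligation. by rewrite /= -fmorph_isometry; exact: singleton_delta. Qed.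
Next Obligation. by rewrite /= -fmorph_isometry; exact: singleton_single. Qed.
Next Obligation. by rewrite /= (fqsup_reindex _ fK) singleton_sup. Qed.

Lemma singleton_map_dist (sigma xi : singleton X) :
  singleton_dist (singleton_map sigma) (singleton_map xi) =
  singleton_dist sigma xi.
Proof. exact: (fqsup_reindex (fun x => sigma x ⊗ xi x) fK). Qed.

Program Definition scott_map : fmorph (scott X) (scott Y) :=
  @FMorph _ _ (scott X) (scott Y) singleton_map _ _.
Next Obligation. by rewrite /= singleton_map_dist. Qed.
Next Obligation. exact: singleton_map_dist. Qed.

End Transport.

Lemma scott_mapK (X Y : QSet Q) (f : fmorph X Y) (g : fmorph Y X)
    (fK : cancel f g) (gK : cancel g f) :
  fmorph_comp (scott_map gK fK) (scott_map fK gK) = fmorph_id (scott X).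
Proof.
apply: fmorph_eq; apply/funext => sigma; apply: singleton_eq.
by apply/funext => x /=; rewrite fK.
Qed.

End FunctionalInvariance.

Theorem mainTheorem5 (d : Order.disp_t) (Q : scsQuantaleType d) :
  (forall X : QSet Q, @isomorphic (QSet_r Q) X (scott X)) /\
  (forall X Y : QSet Q,
     @isomorphic (QSet_f Q) X Y ->
     @isomorphic (QSet_f Q) (scott X) (scott Y)).
Proof.
split=> [X|X Y [f [g [gf fg]]]].
  by exists (to_scott X), (of_scott X); split;
    [exact: to_scottK | exact: of_scottK].
have fK : cancel f g by move=> x; exact: (congr1 (fun h : fmorph X X => h x) gf).
have gK : cancel g f by move=> y; exact: (congr1 (fun h : fmorph Y Y => h y) fg).
by exists (scott_map fK gK), (scott_map gK fK); split; exact: scott_mapK.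
Qed.
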